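(* Let $L$ be the set consisting of the following $21$ squarefree integers: $46$, $430$, $1817$, $58254$, $209991$, $1752299$, $3124318$, $4099215$, $5374184665$, $6459560882$, $16466394154$, $20565608894$, $25666082990$, $117477414815$, $125854178626$, $1004569189366$, $1188580642033$, $15826129757609$, $18803675974841$, $20256129307923$, $39028039587479$. Then no $d\in L$ satisfies (SC), and no $d\in L\setminus\{4099215,39028039587479\}$ satisfies (C).
   Context: A positive integer $f$ is called powerful if for each prime $p$ with $p\mid f$ we have $p^2\mid f$. Let $d\geq 2$ be a squarefree integer and let $\omega=\sqrt{d}$ if $d\equiv 2,3\mod 4$ and $\omega=\frac{1+\sqrt{d}}{2}$ if $d\equiv 1\mod 4$, so that $\mathbb{Z}[\omega]$ is the ring of integers of $\mathbb{Q}(\sqrt{d})$. Let $\varepsilon>1$ be the fundamental unit of $\mathbb{Z}[\omega]$ (i.e., the unit group is $\{\pm\varepsilon^k:k\in\mathbb{Z}\}$), and let $x,y$ be the unique nonnegative integers with $\varepsilon=x+y\omega$. We say that $d$ satisfies (C) if $d\equiv 7\mod 8$ and there are positive integers $k,u,v$ such that $u$ is powerful, $k$ and $v$ are odd, $\varepsilon^k=u+v\sqrt{d}$ and $d\mid v$. We say that $d$ satisfies (SC) if $d\equiv 7\mod 8$, $x$ is powerful, $y$ is odd and $d\mid y$. *)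

(* Defs.v *)
From Stdlib Require Import Reals ZArith Znumtheory List.

Open Scope Z_scope.

Definition squarefree (d : Z) : Prop :=
  0 < d /\ forall p : Z, prime p -> ~ (p ^ 2 | d).

Definition powerful (f : Z) : Prop :=
  0 < f /\ forall p : Z, prime p -> (p | f) -> (p ^ 2 | f).

(* For squarefree [d] the remaining residues modulo 4 are 2 and 3. *)
Definition omega (d : Z) : R :=
  if d mod 4 =? 1 then ((1 + sqrt (IZR d)) / 2)%R else sqrt (IZR d).

(* [omega d] is a root of a monic integer polynomial of degree 2, so the ring
   it generates is the set of integer combinations of 1 and [omega d]. *)
Definition in_Zomega (d : Z) (z : R) : Prop :=
  exists a b : Z, z = (IZR a + IZR b * omega d)%R.

Definition is_unit (d : Z) (z : R) : Prop :=
  in_Zomega d z /\ exists w : R, in_Zomega d w /\ (z * w = 1)%R.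

Definition fundamental_unit (d : Z) (eps : R) : Prop :=
  (1 < eps)%R /\
  forall z : R, is_unit d z <->
    exists k : Z, (z = powerRZ eps k \/ z = - powerRZ eps k)%R.

(* In [condC] and [condSC], [eps] exists by Dirichlet's unit theorem and is
   unique; [x] and [y] are unique because [omega d] is irrational. *)
Definition condC (d : Z) : Prop :=
  d mod 8 = 7 /\
  exists eps : R, fundamental_unit d eps /\
  exists k u v : Z,
    0 < k /\ 0 < u /\ 0 < v /\
    powerful u /\ Z.Odd k /\ Z.Odd v /\
    powerRZ eps k = (IZR u + IZR v * sqrt (IZR d))%R /\
    (d | v).

Definition condSC (d : Z) : Prop :=
  d mod 8 = 7 /\
  exists eps : R, fundamental_unit d eps /\
  exists x y : Z,
    0 <= x /\ 0 <= y /\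
    eps = (IZR x + IZR y * omega d)%R /\
    powerful x /\ Z.Odd y /\ (d | y).

Definition L : list Z :=
  46 :: 430 :: 1817 :: 58254 :: 209991 :: 1752299 :: 3124318 :: 4099215 ::
  5374184665 :: 6459560882 :: 16466394154 :: 20565608894 :: 25666082990 ::
  117477414815 :: 125854178626 :: 1004569189366 :: 1188580642033 ::
  15826129757609 :: 18803675974841 :: 20256129307923 :: 39028039587479 :: nil.

(* Main.v *)
Require Import Defs.
From Stdlib Require Import Reals ZArith Znumtheory List.
From Stdlib Require Import Bool Lia Lra Zpow_facts.

Open Scope Z_scope.

(** Only 209991, 4099215, 117477414815 and 39028039587479 are 7 modulo 8.

    If u^2 - d v^2 = 1 with v odd, then u + 1 = a r^2 and u - 1 = b s^2 with
    ab = d and r, s odd, so that a r^2 - b s^2 = 2. For d = 209991 and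
    d = 117477414815 every factorization d = ab is excluded modulo 8 or modulo a
    small prime divisor of d, which refutes (C), hence (SC).

    For the other two d, let X + Y sqrt d be a known unit of norm 1 with Y odd.
    It is an odd power eps^n of the fundamental unit eps = x + y sqrt d, so that x
    divides X. Let p be a prime such that p divides X, p^2 does not, and d is a
    square modulo p. If n is prime to p - 1, then Fermat's little theorem recovers
    eps modulo p from eps^n, and p divides x as well; then x is not powerful. For
    d = 39028039587479 one takes p = 5, where n odd suffices. For d = 4099215
    one takes p = 701, and n is not a multiple of 5 or 7 because the unit is not a
    5th power modulo 19 nor a 7th power modulo 29 of an element of norm 1. *)

(** * Squarefreeness *)

(** Trial division passes over the proper multiples of 2, 3 and 5: such a divisor of [c] forces 2, 3
    or 5 itself, tried earlier, to divide [c]. *)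
Definition skip (n : Z) : bool :=
  (Z.even n && (2 <? n)) || ((n mod 3 =? 0) && (3 <? n)) ||
  ((n mod 5 =? 0) && (5 <? n)).

Fixpoint no_factor_from (n : Z) (len : nat) (c : Z) : bool :=
  match len with
  | O => true
  | S len' =>
      if skip n || negb (c mod n =? 0) then no_factor_from (n + 1) len' c
      else false
  end.

Definition no_factor (B c : Z) : bool := no_factor_from 2 (Z.to_nat (B - 1)) c.

Lemma no_factor_from_spec (len : nat) (n c q : Z) :
  no_factor_from n len c = true -> n <= q < n + Z.of_nat len -> 0 < q ->
  skip q = false -> ~ (q | c).
Proof.
  revert n; induction len as [|len IH]; intros n H Hq Hpos Hs Hd; [lia|].
  simpl in H.
  destruct (skip n || negb (c mod n =? 0)) eqn:E; [|discriminate].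
  destruct (Z.eq_dec q n) as [->|Hne].
  - rewrite Hs in E; simpl in E.
    apply Z.mod_divide in Hd; [|lia].
    rewrite Hd in E; discriminate.
  - apply (IH (n + 1)); auto; lia.
Qed.

Lemma no_factor_spec (B c q : Z) :
  no_factor B c = true -> 1 < q <= B -> ~ (q | c).
Proof.
  intros H Hq Hd.
  assert (Hf : forall r, 1 < r <= B -> skip r = false -> ~ (r | c)).
  { intros r Hr Hs. apply (no_factor_from_spec _ _ _ _ H); auto; lia. }
  destruct (skip q) eqn:E; [|exact (Hf q Hq E Hd)].
  unfold skip in E.
  apply orb_prop in E as [E|E]; [apply orb_prop in E as [E|E]|];
    apply andb_prop in E as [E1 E2]; apply Z.ltb_lt in E2.
  - apply Z.even_spec in E1 as [t Ht].
    apply (Hf 2); [lia|reflexivity|].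
    apply Z.divide_trans with q; [exists t; lia|exact Hd].
  - apply Z.eqb_eq, Z.mod_divide in E1; [|lia].
    apply (Hf 3); [lia|reflexivity|]. now apply Z.divide_trans with q.
  - apply Z.eqb_eq, Z.mod_divide in E1; [|lia].
    apply (Hf 5); [lia|reflexivity|]. now apply Z.divide_trans with q.
Qed.

Definition prime_test (p : Z) : bool :=
  (1 <? p) && no_factor (Z.sqrt p) p.

Lemma prime_test_spec (p : Z) : prime_test p = true -> prime p.
Proof.
  unfold prime_test; intros H.
  apply andb_prop in H as [H1 H2]. apply Z.ltb_lt in H1.
  apply prime_alt; split; [lia|].
  intros n Hn Hd.
  destruct (Z.sqrt_spec p) as [_ Hs]; [lia|].
  destruct (Z.le_gt_cases n (Z.sqrt p)) as [Hle|Hgt].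
  - apply (no_factor_spec _ _ n H2); [lia|exact Hd].
  (* A divisor above the square root has its cofactor [m] below it. *)
  - destruct Hd as [m Hm].
    apply (no_factor_spec _ _ m H2); [|exists n; lia].
    pose proof (Z.sqrt_nonneg p). unfold Z.succ in Hs. set (s := Z.sqrt p) in *. clearbody s.
    assert (1 < m) by nia. split; [assumption|].
    destruct (Z.le_gt_cases m s); [assumption|].
    assert ((s + 1) * (s + 1) <= m * n) by (apply Z.mul_le_mono_nonneg; lia). lia.
Qed.

Definition squarefree_test (B c : Z) : bool :=
  (0 <? c) && (c <? (B + 1) ^ 3) && negb (Z.sqrt c * Z.sqrt c =? c) &&
  no_factor B c.

(* If p^2 divides c then p and c / p^2 both exceed B unless c = p^2. *)
Lemma squarefree_test_spec (B c : Z) :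
  0 <= B -> squarefree_test B c = true -> squarefree c.
Proof.
  unfold squarefree_test; intros HB H.
  apply andb_prop in H as [H H4]. apply andb_prop in H as [H H3].
  apply andb_prop in H as [H1 H2].
  apply Z.ltb_lt in H1. apply Z.ltb_lt in H2.
  apply negb_true_iff, Z.eqb_neq in H3.
  split; [exact H1|]. intros p Hp [m Hm].
  assert (Hp1 := prime_ge_2 p Hp).
  replace (p ^ 2) with (p * p) in Hm by ring.
  assert (Hm0 : 0 < m) by nia.
  destruct (Z.le_gt_cases p B).
  { apply (no_factor_spec _ _ p H4); [lia|]. exists (m * p); lia. }
  destruct (Z.eq_dec m 1) as [->|].
  { apply H3. rewrite Hm. rewrite Z.mul_1_l, Z.sqrt_square; lia. }
  destruct (Z.le_gt_cases m B).
  { apply (no_factor_spec _ _ m H4); [lia|]. exists (p * p); lia. }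
  replace ((B + 1) ^ 3) with ((B + 1) * ((B + 1) * (B + 1))) in H2 by ring.
  assert ((B + 1) * (B + 1) <= p * p) by nia.
  nia.
Qed.

(** A prime r other than p has r^2 coprime to p, so r^2 would already divide c; and p^2 dividing p c
    would give p dividing c. *)
Lemma squarefree_mul_prime (p c : Z) :
  prime p -> ~ (p | c) -> squarefree c -> squarefree (p * c).
Proof.
  intros Hp Hpc [Hc Hsq]. assert (H2 := prime_ge_2 p Hp).
  split; [nia|]. intros r Hr Hd.
  assert (Hr2 := prime_ge_2 r Hr).
  destruct (Z.eq_dec r p) as [->|Hne].
  - apply Hpc. destruct Hd as [t Ht]. exists t.
    apply (Z.mul_reg_l _ _ p); [lia|]. rewrite Ht; ring.
  - apply (Hsq r Hr). apply Gauss with p; [exact Hd|].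
    apply rel_prime_sym. replace (r ^ 2) with (r * r) by ring.
    assert (rel_prime p r).
    { apply prime_rel_prime; [exact Hp|]. intros Hdiv.
      apply (prime_div_prime p r Hp Hr) in Hdiv. congruence. }
    now apply rel_prime_mult.
Qed.

(** Peeling off known primes shrinks the cofactor, so that trial division only has to reach its cube
    root. *)
Fixpoint squarefree_cert (ps : list Z) (B c : Z) : bool :=
  match ps with
  | nil => (0 <=? B) && squarefree_test B c
  | p :: ps' =>
      prime_test p && (c mod p =? 0) && negb ((c / p) mod p =? 0) &&
      squarefree_cert ps' B (c / p)
  end.

Lemma squarefree_cert_spec (ps : list Z) (B c : Z) :
  squarefree_cert ps B c = true -> squarefree c.
Proof.
  revert c; induction ps as [|p ps IH]; intros c H; simpl in H.
  - apply andb_prop in H as [H1 H2]. apply Z.leb_le in H1.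
    now apply squarefree_test_spec with B.
  - apply andb_prop in H as [H H4]. apply andb_prop in H as [H H3].
    apply andb_prop in H as [H1 H2].
    apply prime_test_spec in H1. assert (Hp := prime_ge_2 p H1).
    apply Z.eqb_eq in H2. apply negb_true_iff, Z.eqb_neq in H3.
    replace c with (p * (c / p)) by (symmetry; apply Z.div_exact; lia).
    apply squarefree_mul_prime; [exact H1| |now apply IH].
    intros Hd. apply H3. apply Z.mod_divide; [lia|exact Hd].
Qed.

(* [(d, ps, B)]: [ps] are prime factors of [d], and [B] is at least the integer
   cube root of the remaining cofactor. *)
Definition squarefree_certs : list (Z * list Z * Z) :=
  (46, 2 :: nil, 3) :: (430, 2 :: 5 :: nil, 4) :: (1817, 23 :: nil, 5) ::
  (58254, 2 :: 3 :: 7 :: 19 :: nil, 5) :: (209991, 3 :: nil, 42) ::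
  (1752299, 41 :: 79 :: nil, 9) :: (3124318, 2 :: nil, 117) ::
  (4099215, 3 :: 5 :: nil, 65) :: (5374184665, 5 :: nil, 1025) ::
  (6459560882, 2 :: 619 :: 631 :: nil, 21) ::
  (16466394154, 2 :: 7 :: 883 :: nil, 111) ::
  (20565608894, 2 :: 1021 :: nil, 216) ::
  (25666082990, 2 :: 5 :: 2459 :: nil, 102) ::
  (117477414815, 5 :: 73 :: 739 :: nil, 76) ::
  (125854178626, 2 :: 11 :: 17 :: nil, 696) ::
  (1004569189366, 2 :: nil, 7950) ::
  (1188580642033, 71 :: 114221 :: nil, 53) ::
  (15826129757609, 561367 :: nil, 305) ::
  (18803675974841, 3767 :: 41047 :: nil, 50) ::
  (20256129307923, 3 :: 569 :: 2659 :: nil, 165) ::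
  (39028039587479, nil, 33921) :: nil.

Lemma squarefree_L (d : Z) : In d L -> squarefree d.
Proof.
  replace L with (map (fun x => fst (fst x)) squarefree_certs) by reflexivity.
  intros Hd. apply in_map_iff in Hd as ([[d' ps] B] & <- & Hx); simpl.
  apply (squarefree_cert_spec ps B).
  assert (H : forallb
    (fun x => squarefree_cert (snd (fst x)) (snd x) (fst (fst x)))
    squarefree_certs = true) by (vm_cast_no_check (eq_refl true)).
  rewrite forallb_forall in H. exact (H _ Hx).
Qed.

(** * Units and Pell's equation *)

Lemma div_mod_of_mod_eq (a m r : Z) : 0 < m -> a mod m = r -> a = m * (a / m) + r.
Proof. intros Hm <-. apply Z.div_mod; lia. Qed.

(* The pair [(a, b)] stands for [a + b * sqrt d]. *)
Definition qmul (d : Z) (p q : Z * Z) : Z * Z :=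
  (fst p * fst q + d * (snd p * snd q), fst p * snd q + snd p * fst q).

Fixpoint qpow (d : Z) (p : Z * Z) (n : nat) : Z * Z :=
  match n with
  | O => (1, 0)
  | S n' => qmul d p (qpow d p n')
  end.

Definition qnorm (d : Z) (p : Z * Z) : Z :=
  fst p * fst p - d * (snd p * snd p).

Definition qval (d : Z) (p : Z * Z) : R :=
  (IZR (fst p) + IZR (snd p) * sqrt (IZR d))%R.

Lemma qnorm_mul (d : Z) (p q : Z * Z) :
  qnorm d (qmul d p q) = qnorm d p * qnorm d q.
Proof. unfold qnorm, qmul; cbn [fst snd]; ring. Qed.

Lemma qnorm_pow (d : Z) (p : Z * Z) (n : nat) :
  qnorm d p = 1 -> qnorm d (qpow d p n) = 1.
Proof.
  intros H; induction n as [|n IH]; simpl.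
  - unfold qnorm; cbn [fst snd]; ring.
  - rewrite qnorm_mul, H, IH; ring.
Qed.

Lemma qpow_add (d : Z) (p : Z * Z) (m n : nat) :
  qpow d p (m + n) = qmul d (qpow d p m) (qpow d p n).
Proof.
  induction m as [|m IH]; simpl.
  - unfold qmul; cbn [fst snd]. destruct (qpow d p n); cbn [fst snd]. f_equal; ring.
  - rewrite IH. unfold qmul; cbn [fst snd]. f_equal; ring.
Qed.

Lemma qpow_mul (d : Z) (p : Z * Z) (m n : nat) :
  qpow d p (m * n) = qpow d (qpow d p n) m.
Proof.
  induction m as [|m IH]; simpl; [reflexivity|].
  now rewrite qpow_add, IH.
Qed.

Lemma qval_mul (d : Z) (p q : Z * Z) :
  0 <= d -> qval d (qmul d p q) = (qval d p * qval d q)%R.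
Proof.
  intros Hd. unfold qval, qmul; simpl.
  rewrite !plus_IZR, !mult_IZR.
  rewrite <- (sqrt_sqrt (IZR d)) at 1 by (apply IZR_le; lia).
  ring.
Qed.

Lemma qval_pow (d : Z) (p : Z * Z) (n : nat) :
  0 <= d -> qval d (qpow d p n) = (qval d p ^ n)%R.
Proof.
  intros Hd; induction n as [|n IH]; simpl.
  - unfold qval; simpl; ring.
  - now rewrite qval_mul, IH.
Qed.

(** Irrationality of sqrt d by descent: since d = -1 modulo 4, u^2 + v^2 is 0 modulo 4, so u and v
    are both even and can be halved. *)
Lemma square_ne_mul_square (d u v : Z) :
  d mod 4 = 3 -> u * u = d * (v * v) -> v = 0.
Proof.
  intros Hd.
  assert (H : forall n u v, 0 <= v < n -> u * u = d * (v * v) -> v = 0).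
  { intros n; destruct (Z.le_gt_cases 0 n) as [Hn|]; [|lia].
    pattern n; apply natlike_ind; [lia| |exact Hn].
    clear n Hn u v; intros n Hn IH u v Hv E.
    destruct (Z.eq_dec v 0) as [|Hv0]; [assumption|exfalso].
    apply div_mod_of_mod_eq in Hd; [|lia].
    assert (Hu := Z.div_mod u 2 ltac:(lia)).
    assert (Hw := Z.div_mod v 2 ltac:(lia)).
    assert (Hu2 := Z.mod_pos_bound u 2 ltac:(lia)).
    assert (Hw2 := Z.mod_pos_bound v 2 ltac:(lia)).
    set (a := u / 2) in *. set (b := v / 2) in *. set (k := d / 4) in *.
    assert (C : (u mod 2 = 0 \/ u mod 2 = 1) /\ (v mod 2 = 0 \/ v mod 2 = 1))
      by lia.
    destruct C as [[Cu|Cu] [Cv|Cv]]; rewrite Cu in Hu; rewrite Cv in Hw;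
      rewrite Hu, Hw, Hd in E; [|exfalso; lia ..].
    assert (b = 0); [|lia].
    apply (IH a b); lia. }
  intros E. assert (Z.abs v = 0); [|lia].
  apply (H (Z.abs v + 1) u); [lia|].
  now rewrite <- Z.abs_mul, Z.abs_eq by nia.
Qed.

Lemma qval_inj (d : Z) (p q : Z * Z) :
  0 < d -> d mod 4 = 3 -> qval d p = qval d q -> p = q.
Proof.
  intros Hd0 Hd E. destruct p as [a b], q as [a' b'].
  unfold qval in E; simpl in E.
  assert (Hb : b' - b = 0).
  { apply (square_ne_mul_square d (a - a')); [exact Hd|].
    apply eq_IZR. rewrite !mult_IZR, !minus_IZR.
    rewrite <- (sqrt_sqrt (IZR d)) by (apply IZR_le; lia).
    replace (IZR a - IZR a')%R with ((IZR b' - IZR b) * sqrt (IZR d))%R by lra.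
    ring. }
  assert (b' = b) by lia; subst b'.
  assert (IZR a = IZR a') as ->%eq_IZR by lra. reflexivity.
Qed.

Lemma omega_sqrt (d : Z) : d mod 4 = 3 -> omega d = sqrt (IZR d).
Proof. intros H; unfold omega; now rewrite H. Qed.

(** The norm is multiplicative, so a unit has norm 1 or -1, and x^2 - d y^2 = x^2 + y^2 is never -1
    modulo 4. Conversely the conjugate of an element of norm 1 is its inverse. *)
Lemma is_unit_qval (d : Z) (p : Z * Z) :
  0 < d -> d mod 4 = 3 -> is_unit d (qval d p) <-> qnorm d p = 1.
Proof.
  intros Hd0 Hd; split.
  - intros [_ (w & (a & b & ->) & E)].
    rewrite (omega_sqrt d Hd) in E.
    change (qval d p * qval d (a, b) = 1)%R in E.
    rewrite <- qval_mul in E by lia.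
    replace 1%R with (qval d (1, 0)) in E by (unfold qval; simpl; ring).
    apply qval_inj in E; [|assumption ..].
    apply (f_equal (qnorm d)) in E. rewrite qnorm_mul in E.
    unfold qnorm at 3 in E; cbn [fst snd] in E.
    assert (H1 : qnorm d p = 1 \/ qnorm d p = -1).
    { apply Z.eq_mul_1 with (qnorm d (a, b)). rewrite E; ring. }
    destruct H1 as [|H1]; [assumption|exfalso].
    unfold qnorm in H1. destruct p as [x y]; cbn [fst snd] in H1.
    apply div_mod_of_mod_eq in Hd; [|lia].
    assert (Hu := Z.div_mod x 2 ltac:(lia)).
    assert (Hw := Z.div_mod y 2 ltac:(lia)).
    assert (Hu2 := Z.mod_pos_bound x 2 ltac:(lia)).
    assert (Hw2 := Z.mod_pos_bound y 2 ltac:(lia)).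
    assert (C : (x mod 2 = 0 \/ x mod 2 = 1) /\ (y mod 2 = 0 \/ y mod 2 = 1))
      by lia.
    destruct C as [[Cu|Cu] [Cv|Cv]]; rewrite Cu in Hu; rewrite Cv in Hw;
      rewrite Hu, Hw, Hd in H1; lia.
  - intros H. unfold is_unit, in_Zomega. rewrite (omega_sqrt d Hd).
    split; [exists (fst p), (snd p); reflexivity|].
    exists (qval d (fst p, - snd p)). split.
    + exists (fst p), (- snd p); reflexivity.
    + rewrite <- qval_mul by lia.
      replace (qmul d p (fst p, - snd p)) with (1, 0).
      { unfold qval; simpl; ring. }
      unfold qnorm in H. unfold qmul; cbn [fst snd]. f_equal; [rewrite <- H; ring|ring].
Qed.

Lemma mod8_mod4 (d : Z) : d mod 8 = 7 -> d mod 4 = 3.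
Proof.
  intros H. apply div_mod_of_mod_eq in H; [|lia].
  symmetry; apply Z.mod_unique with (2 * (d / 8) + 1); lia.
Qed.

Lemma even_of_qnorm (d u v : Z) :
  Z.Odd d -> Z.Odd v -> u * u - d * (v * v) = 1 -> Z.Even u.
Proof.
  intros [k ->] [m ->] E. destruct (Z.Even_or_Odd u) as [|[j ->]]; [assumption|].
  exfalso; lia.
Qed.

(** With g = gcd(m, v), m = x g and v = y g, one gets x n = g y^2. Then x divides g because it is
    coprime to y, and g divides x because it is coprime to n; hence m = g^2. *)
Lemma square_of_coprime_mul (m n v : Z) :
  0 < m -> rel_prime m n -> m * n = v * v -> exists r, m = r * r.
Proof.
  intros Hm Hmn E.
  set (g := Z.gcd m v).
  assert (Hg : 0 < g).
  { assert (H := Z.gcd_nonneg m v).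
    assert (g <> 0); [|unfold g in *; lia].
    intros Z0; apply Z.gcd_eq_0_l in Z0; lia. }
  destruct (Z.gcd_divide_l m v) as [x Hx].
  destruct (Z.gcd_divide_r m v) as [y Hy]. fold g in Hx, Hy.
  assert (Hxy : rel_prime x y).
  { apply Zgcd_1_rel_prime.
    apply (Z.mul_reg_l _ _ g); [lia|].
    rewrite <- Z.gcd_mul_mono_l_nonneg by lia.
    replace (g * x) with m by lia. replace (g * y) with v by lia. fold g; ring. }
  assert (E2 : x * n = g * (y * y)).
  { apply (Z.mul_reg_l _ _ g); [lia|].
    transitivity (m * n); [rewrite Hx at 1; ring|]. rewrite E, Hy; ring. }
  assert (Hxg : (x | g)).
  { apply Gauss with (y * y); [exists n; lia|]. now apply rel_prime_mult. }
  assert (Hgx : (g | x)).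
  { apply Gauss with n; [exists (y * y); lia|].
    apply rel_prime_div with m; [exact Hmn|]. exists x; lia. }
  assert (x = g).
  { apply Z.divide_antisym_nonneg; [nia|lia|assumption ..]. }
  exists g. congruence.
Qed.

(* [u + 1] and [u - 1] are coprime with product [d v^2]. *)
Lemma pell_split (d u v : Z) :
  0 < d -> 0 < u -> Z.Odd d -> Z.Odd v -> u * u - d * (v * v) = 1 ->
  exists a b r s, 0 < a /\ a * b = d /\ Z.Odd r /\ Z.Odd s /\
    a * (r * r) - b * (s * s) = 2.
Proof.
  intros Hd Hu Hdo Hvo E.
  assert (Hue := even_of_qnorm d u v Hdo Hvo E).
  assert (Hv0 : v <> 0) by (destruct Hvo; lia).
  assert (Hvv : 0 < v * v) by nia.
  assert (Hu2 : 2 <= u) by nia.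
  (* The factor [a] is the part of d inside u + 1; what remains, [b], must divide u - 1, and the
     quotients [m] and [n] are coprime with product v^2. *)
  set (a := Z.gcd (u + 1) d).
  destruct (Z.gcd_divide_l (u + 1) d) as [m Hm].
  destruct (Z.gcd_divide_r (u + 1) d) as [b Hb]. fold a in Hm, Hb.
  assert (Ha : 0 < a).
  { assert (0 <= a) by apply Z.gcd_nonneg.
    assert (a <> 0); [|lia]. intros Z0. rewrite Z0 in Hm. lia. }
  assert (Hcop : rel_prime (u + 1) (u - 1)).
  { apply bezout_rel_prime. destruct Hue as [k Hk].
    apply Bezout_intro with (1 - k) k. lia. }
  assert (Hmb : rel_prime b m).
  { apply rel_prime_sym, Zgcd_1_rel_prime.
    apply (Z.mul_reg_l _ _ a); [lia|].
    rewrite <- Z.gcd_mul_mono_l_nonneg by lia.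
    replace (a * m) with (u + 1) by lia. replace (a * b) with d by lia.
    fold a; ring. }
  assert (E1 : m * (u - 1) = b * (v * v)).
  { apply (Z.mul_reg_l _ _ a); [lia|].
    replace (a * (m * (u - 1))) with ((u + 1) * (u - 1)) by (rewrite Hm; ring).
    replace (a * (b * (v * v))) with (d * (v * v)) by (rewrite Hb at 1; ring).
    lia. }
  destruct (Gauss b m (u - 1)) as [n Hn]; [exists (v * v); lia|exact Hmb|].
  assert (Hbp : 0 < b) by nia.
  assert (E2 : m * n = v * v).
  { apply (Z.mul_reg_l _ _ b); [lia|]. rewrite <- E1, Hn; ring. }
  assert (Hmn : rel_prime m n).
  { apply rel_prime_div with (u + 1); [|exists a; lia].
    apply rel_prime_sym, rel_prime_div with (u - 1); [|exists b; lia].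
    now apply rel_prime_sym. }
  destruct (square_of_coprime_mul m n v) as [r Hr]; [nia|assumption ..|].
  destruct (square_of_coprime_mul n m v) as [s Hs];
    [nia|now apply rel_prime_sym|lia|].
  exists a, b, r, s.
  assert (Hro : forall t q w, w = q * (t * t) -> Z.Odd w -> Z.Odd t).
  { intros t q w -> [k Hk]. destruct (Z.Even_or_Odd t) as [[j ->]|]; [|assumption].
    exfalso; lia. }
  destruct Hue as [k Hk].
  repeat split; [exact Ha|lia| | |].
  - apply (Hro r a (u + 1)); [rewrite Hm, Hr; ring|exists k; lia].
  - apply (Hro s b (u - 1)); [rewrite Hn, Hs; ring|exists (k - 1); lia].
  - rewrite <- Hr, <- Hs. lia.
Qed.

(** * Excluding the factorizations d = ab by congruences *)

Fixpoint divisors_of_primes (ps : list Z) : list Z :=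
  match ps with
  | nil => 1 :: nil
  | p :: ps' =>
      let l := divisors_of_primes ps' in l ++ map (Z.mul p) l
  end.

Lemma divisors_of_primes_spec (ps : list Z) (a : Z) :
  Forall prime ps -> 0 < a -> (a | fold_right Z.mul 1 ps) ->
  In a (divisors_of_primes ps).
Proof.
  revert a; induction ps as [|p ps IH]; intros a Hps Ha Hd; simpl in *.
  - left. symmetry. apply Z.divide_1_r_nonneg; [lia|exact Hd].
  - inversion Hps as [|? ? Hp Hps']; subst.
    assert (Hp2 := prime_ge_2 p Hp).
    apply in_or_app.
    destruct (Zdivide_dec p a) as [[a' ->]|Hna].
    + right. apply in_map_iff. exists a'; split; [ring|].
      apply IH; [assumption|nia|].
      apply (Z.mul_divide_cancel_l _ _ p); [lia|].
      now rewrite (Z.mul_comm p a').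
    + left. apply IH; [assumption ..|].
      apply Gauss with p; [exact Hd|]. now apply rel_prime_sym, prime_rel_prime.
Qed.

Definition no_square_root (p c e : Z) : bool :=
  forallb (fun i => negb ((c * (Z.of_nat i * Z.of_nat i) - e) mod p =? 0))
    (seq 0 (Z.to_nat p)).

Lemma no_square_root_spec (p c e t : Z) :
  0 < p -> no_square_root p c e = true -> ~ (p | c * (t * t) - e).
Proof.
  intros Hp H Hd. unfold no_square_root in H; rewrite forallb_forall in H.
  assert (Ht := Z.mod_pos_bound t p Hp).
  specialize (H (Z.to_nat (t mod p))).
  rewrite Z2Nat.id in H by lia.
  apply negb_true_iff, Z.eqb_neq in H; [|apply in_seq; lia].
  apply H, Z.mod_divide; [lia|].
  assert (Hdm := Z.div_mod t p ltac:(lia)).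
  replace (c * (t mod p * (t mod p)) - e) with
    ((c * (t * t) - e) - p * (c * (t / p) * (t + t mod p))).
  - apply Z.divide_sub_r; [exact Hd|apply Z.divide_factor_l].
  - set (r := t mod p) in *. set (k := t / p) in *. rewrite Hdm. ring.
Qed.

(** Odd squares are 1 modulo 8, so a r^2 - b s^2 = 2 forces a - b = 2 modulo 8. Modulo a prime
    dividing a it reads b s^2 = -2, and modulo one dividing b it reads a r^2 = 2. *)
Definition split_obstructed (ps : list Z) (a b : Z) : bool :=
  negb ((a - b - 2) mod 8 =? 0) ||
  existsb (fun p => (0 <? p) &&
    (((a mod p =? 0) && no_square_root p b (-2)) ||
     ((b mod p =? 0) && no_square_root p a 2))) ps.

Lemma split_obstructed_spec (ps : list Z) (a b r s : Z) :
  split_obstructed ps a b = true -> Z.Odd r -> Z.Odd s ->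
  a * (r * r) - b * (s * s) <> 2.
Proof.
  intros H [i Hi] [j Hj] E. apply orb_prop in H as [H|H].
  - apply negb_true_iff, Z.eqb_neq in H. apply H, Z.mod_divide; [lia|].
    (* This puts (2i + 1)^2 = 4 i (i + 1) + 1 in the form 8w + 1. *)
    assert (T : forall i, exists w, i * (i + 1) = 2 * w).
    { intros w. destruct (Z.Even_or_Odd w) as [[q ->]|[q ->]].
      - exists (q * (2 * q + 1)); ring.
      - exists ((2 * q + 1) * (q + 1)); ring. }
    destruct (T i) as [w Hw]. destruct (T j) as [z Hz].
    exists (b * z - a * w).
    assert (r * r = 8 * w + 1) by (rewrite Hi; lia).
    assert (s * s = 8 * z + 1) by (rewrite Hj; lia).
    replace (r * r) with (8 * w + 1) in E. replace (s * s) with (8 * z + 1) in E.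
    lia.
  - apply existsb_exists in H as (p & _ & H).
    apply andb_prop in H as [Hp H]. apply Z.ltb_lt in Hp.
    apply orb_prop in H as [H|H]; apply andb_prop in H as [H1 H2];
      apply Z.eqb_eq, Z.mod_divide in H1 as [k Hk]; try lia.
    + apply (no_square_root_spec _ _ _ s Hp H2).
      exists (k * (r * r)). rewrite Hk in E. lia.
    + apply (no_square_root_spec _ _ _ r Hp H2).
      exists (k * (s * s)). rewrite Hk in E. lia.
Qed.

(** Only primes below 1000 serve as moduli, since the search runs through all residues; the larger
    ones still enter the list of divisors. *)
Definition all_splits_obstructed (d : Z) (ps : list Z) : bool :=
  (0 <? d) && Z.odd d && (fold_right Z.mul 1 ps =? d) && forallb prime_test ps &&
  forallb (fun a => split_obstructed (filter (fun p => p <? 1000) ps) a (d / a))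
    (divisors_of_primes ps).

Lemma no_odd_pell_solution (d : Z) (ps : list Z) (u v : Z) :
  all_splits_obstructed d ps = true -> 0 < u -> Z.Odd v ->
  u * u - d * (v * v) <> 1.
Proof.
  intros H Hu Hv E. unfold all_splits_obstructed in H.
  apply andb_prop in H as [H H5]. apply andb_prop in H as [H H4].
  apply andb_prop in H as [H H3]. apply andb_prop in H as [H1 H2].
  apply Z.ltb_lt in H1. apply Z.odd_spec in H2. apply Z.eqb_eq in H3.
  rewrite forallb_forall in H4, H5.
  destruct (pell_split d u v) as (a & b & r & s & Ha & Hab & Hr & Hs & E2);
    try assumption.
  apply (split_obstructed_spec (filter (fun p => p <? 1000) ps) a b r s);
    try assumption.
  replace b with (d / a) by (symmetry; apply Z.div_unique_exact; lia).
  apply H5. apply divisors_of_primes_spec; [|exact Ha|].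
  - apply Forall_forall. intros p Hp. now apply prime_test_spec, H4.
  - rewrite H3. exists b; lia.
Qed.

Lemma not_condC_of_all_splits_obstructed (d : Z) (ps : list Z) :
  all_splits_obstructed d ps = true -> ~ condC d.
Proof.
  intros H (Hd & eps & [_ Hf] & k & u & v & _ & Hu & _ & _ & _ & Hv & E & _).
  apply (no_odd_pell_solution d ps u v H Hu Hv).
  assert (Hd0 : 0 < d).
  { unfold all_splits_obstructed in H. rewrite !andb_true_iff in H.
    destruct H as [[[[H _] _] _] _]. now apply Z.ltb_lt. }
  change (qnorm d (u, v) = 1).
  apply is_unit_qval; [exact Hd0|now apply mod8_mod4|].
  apply Hf. exists k. left. symmetry. exact E.
Qed.

Lemma not_condC_209991 : ~ condC 209991.
Proof.
  apply not_condC_of_all_splits_obstructed with (3 :: 69997 :: nil). vm_cast_no_check (eq_refl true).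
Qed.

Lemma not_condC_117477414815 : ~ condC 117477414815.
Proof.
  apply not_condC_of_all_splits_obstructed with (5 :: 73 :: 739 :: 435529 :: nil).
  vm_cast_no_check (eq_refl true).
Qed.

(** * Known units as odd powers of the fundamental unit *)

(** The given unit is, up to sign, a power of [eps]. Its value is at least 1, which excludes the
    minus sign and negative exponents; an even power is a square, whose second coordinate 2fg is
    even. *)
Lemma fundamental_unit_odd_power (d x y X Y : Z) (eps : R) :
  0 < d -> d mod 4 = 3 -> fundamental_unit d eps -> eps = qval d (x, y) ->
  0 <= X -> 0 < Y -> Z.Odd Y -> qnorm d (X, Y) = 1 ->
  exists n : nat, Nat.Odd n /\ qpow d (x, y) n = (X, Y).
Proof.
  intros Hd0 Hd [H1 Hf] -> HX HY HYo Hn.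
  assert (Hs : (0 <= sqrt (IZR d))%R) by apply sqrt_pos.
  assert (HX1 : 1 <= X).
  { unfold qnorm in Hn; cbn [fst snd] in Hn. nia. }
  assert (Hpos : (1 <= qval d (X, Y))%R).
  { unfold qval; cbn [fst snd]. apply IZR_le in HX1. apply IZR_lt in HY. nra. }
  apply is_unit_qval in Hn; [|assumption ..].
  apply Hf in Hn as [k Hk].
  assert (Hp : (0 < powerRZ (qval d (x, y)) k)%R) by (apply powerRZ_lt; lra).
  destruct Hk as [Hk|Hk]; [|lra].
  assert (Hn : exists n : nat, qpow d (x, y) n = (X, Y)).
  { destruct k as [|k|k].
    - exists O. apply (qval_inj d); [assumption ..|].
      rewrite qval_pow by lia. rewrite Hk. reflexivity.
    - exists (Pos.to_nat k). apply (qval_inj d); [assumption ..|].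
      rewrite qval_pow by lia. rewrite Hk. reflexivity.
    - exfalso. simpl in Hk, Hp.
      assert (H2 : (1 < qval d (x, y) ^ Pos.to_nat k)%R)
        by (apply Rlt_pow_R1; lia || lra).
      assert (H3 : (/ (qval d (x, y) ^ Pos.to_nat k) < 1)%R).
      { rewrite <- Rinv_1. apply Rinv_lt_contravar; lra. }
      lra. }
  destruct Hn as [n Hn]. exists n; split; [|exact Hn].
  destruct (Nat.Even_or_Odd n) as [[m ->]|]; [exfalso|assumption].
  rewrite qpow_mul in Hn. apply (f_equal snd) in Hn.
  cbn [qpow qmul fst snd] in Hn. destruct HYo as [j ->].
  lia.
Qed.

(** Modulo x the base is y sqrt d, so even powers have second coordinate 0 and odd powers have first
    coordinate 0. *)
Lemma divide_fst_qpow_odd (d x y : Z) (n : nat) :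
  Nat.Odd n -> (x | fst (qpow d (x, y) n)).
Proof.
  intros [m ->].
  assert (H : forall m, (x | snd (qpow d (x, y) (2 * m))) /\
                        (x | fst (qpow d (x, y) (2 * m + 1)))).
  { clear m.
    assert (S1 : forall m, (x | snd (qpow d (x, y) (2 * m))) ->
                           (x | fst (qpow d (x, y) (2 * m + 1)))).
    { intros m [t Ht]. rewrite Nat.add_1_r. cbn [qpow qmul fst snd].
      rewrite Ht. exists (fst (qpow d (x, y) (2 * m)) + d * (y * t)). ring. }
    induction m as [|m [IH1 IH2]].
    - split; [exists 0; reflexivity|]. apply S1. exists 0; reflexivity.
    - assert (H2 : (x | snd (qpow d (x, y) (2 * S m)))); [|auto].
      replace (2 * S m)%nat with (S (2 * m + 1)) by lia.
      cbn [qpow qmul fst snd]. destruct IH2 as [t ->].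
      exists (snd (qpow d (x, y) (2 * m + 1)) + y * t). ring. }
  apply H.
Qed.

(** If x were powerful, p dividing x would give p^2 dividing x, and x divides X. Absolute values
    keep the norm and yield a unit that is at least 1, whatever the signs of X and Y. *)
Lemma not_condSC_of_unit (d p X Y : Z) :
  0 < d -> prime p -> qnorm d (X, Y) = 1 -> Z.Odd Y -> ~ (p ^ 2 | X) ->
  (forall x y n, Nat.Odd n -> qnorm d (x, y) = 1 ->
     qpow d (x, y) n = (Z.abs X, Z.abs Y) -> (p | x)) ->
  ~ condSC d.
Proof.
  intros Hd0 Hp Hn HY Hp2 H (Hd & eps & Hf & x & y & _ & _ & E & [_ Hx] & _ & _).
  apply mod8_mod4 in Hd.
  rewrite (omega_sqrt d Hd) in E. change (eps = qval d (x, y)) in E.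
  destruct (fundamental_unit_odd_power d x y (Z.abs X) (Z.abs Y) eps)
    as (n & Hno & Hpow); try assumption; try lia.
  - destruct HY; lia.
  - destruct HY as [j ->]. destruct (Z.abs_eq_or_opp (2 * j + 1)) as [-> | ->].
    + exists j; lia.
    + exists (- j - 1); lia.
  - rewrite <- Hn. unfold qnorm; cbn [fst snd].
    now rewrite <- !Z.abs_mul, !Z.abs_eq by apply Z.square_nonneg.
  - assert (Hxn : qnorm d (x, y) = 1).
    { apply is_unit_qval; [assumption ..|]. apply (proj2 Hf).
      exists 1. left. rewrite powerRZ_1. now symmetry. }
    apply Hp2. apply Z.divide_trans with x.
    + apply Hx; [exact Hp|]. now apply (H x y n).
    + apply Z.divide_abs_r. change (Z.abs X) with (fst (Z.abs X, Z.abs Y)).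
      rewrite <- Hpow. now apply divide_fst_qpow_odd.
Qed.

(** * Fermat's little theorem and inverting powers modulo p *)

Definition fermat_test (p : Z) : bool :=
  forallb (fun i => Zpow_mod (Z.of_nat i) p p =? Z.of_nat i)
    (seq 0 (Z.to_nat p)).

Lemma fermat_test_spec (p a : Z) :
  1 < p -> fermat_test p = true -> a ^ p mod p = a mod p.
Proof.
  intros Hp H. unfold fermat_test in H. rewrite forallb_forall in H.
  assert (Ha := Z.mod_pos_bound a p ltac:(lia)).
  specialize (H (Z.to_nat (a mod p))).
  rewrite Z2Nat.id, Z.eqb_eq, Zpow_mod_correct in H by lia.
  rewrite Zpower_mod by lia. apply H, in_seq. lia.
Qed.

(** The exponent grows by p - 1 at a time, and the spare factor a completes a^(p-1) to a^p;
    multiples of p thus need no separate case. *)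
Lemma fermat_pow (p a w : Z) :
  1 < p -> fermat_test p = true -> 0 <= w ->
  a ^ (1 + (p - 1) * w) mod p = a mod p.
Proof.
  intros Hp H Hw. pattern w; apply natlike_ind; [| |exact Hw].
  - rewrite Z.mul_0_r, Z.add_0_r, Z.pow_1_r. reflexivity.
  - clear w Hw; intros w Hw IH.
    replace (1 + (p - 1) * Z.succ w) with ((1 + (p - 1) * w) + (p - 1)) by ring.
    rewrite Z.pow_add_r, Z.mul_mod, IH, <- Z.mul_mod by nia.
    rewrite <- Z.pow_succ_r by lia.
    replace (Z.succ (p - 1)) with p by lia.
    now apply fermat_test_spec.
Qed.

(* A root s of d modulo p gives the ring map a + b sqrt d |-> a + b s. *)
Lemma qpow_residue (d p s x y : Z) (n : nat) :
  (p | s * s - d) ->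
  (p | fst (qpow d (x, y) n) + s * snd (qpow d (x, y) n) -
       (x + s * y) ^ Z.of_nat n).
Proof.
  intros [k Hk]; induction n as [|n [t Ht]].
  - exists 0. cbn [qpow fst snd Z.of_nat]. rewrite Z.pow_0_r. ring.
  - rewrite Nat2Z.inj_succ, Z.pow_succ_r by lia. cbn [qpow qmul fst snd].
    set (f := fst (qpow d (x, y) n)) in *. set (g := snd (qpow d (x, y) n)) in *.
    set (c := (x + s * y) ^ Z.of_nat n) in *.
    replace c with (f + s * g - t * p) by lia.
    replace d with (s * s - k * p) by lia.
    exists ((x + s * y) * t - k * y * g). ring.
Qed.

(* With n k = 1 mod p - 1, raising A^n = - B^n to the power k gives A = - B,
   for A, B = x +- s y. *)
Lemma divide_fst_of_divide_fst_qpow (d p s x y : Z) (n : nat) :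
  prime p -> Z.Odd p -> fermat_test p = true -> (p | s * s - d) ->
  rel_prime (Z.of_nat n) (p - 1) -> (p | fst (qpow d (x, y) n)) -> (p | x).
Proof.
  intros Hp Hpo Hf Hs Hrel HX. assert (Hp2 := prime_ge_2 p Hp).
  assert (Hp3 : 3 <= p) by (destruct Hpo; lia).
  assert (HA := qpow_residue d p s x y n Hs).
  assert (HB := qpow_residue d p (- s) x y n).
  rewrite Z.mul_opp_opp in HB. specialize (HB Hs).
  set (N := Z.of_nat n) in *. assert (HN : 0 <= N) by lia.
  set (A := x + s * y) in *. set (B := x + - s * y) in *.
  destruct (rel_prime_bezout _ _ Hrel) as [u v Huv].
  (* The Bezout coefficient is reduced modulo p - 1 to be a nonnegative exponent, and [w] is the
     quotient matching this reduction. *)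
  set (k := u mod (p - 1)).
  assert (Hk := Z.mod_pos_bound u (p - 1) ltac:(lia)). fold k in Hk.
  assert (Hu := Z.div_mod u (p - 1) ltac:(lia)). fold k in Hu.
  set (w := - (v + N * (u / (p - 1)))).
  assert (HNk : N * k = 1 + (p - 1) * w).
  { unfold w. replace k with (u - (p - 1) * (u / (p - 1))) by lia.
    replace (N * (u - (p - 1) * (u / (p - 1)))) with
      ((u * N + v * (p - 1)) - (p - 1) * (v + N * (u / (p - 1)))) by ring.
    rewrite Huv. ring. }
  assert (Hw : 0 <= w).
  { assert (0 <= N * k) by (apply Z.mul_nonneg_nonneg; lia). nia. }
  assert (Hko : Z.Odd k).
  { destruct (Z.Even_or_Odd k) as [[j Hj]|]; [exfalso|assumption].
    destruct Hpo as [i Hi]. rewrite Hj, Hi in HNk.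
    assert (2 * (N * j - i * w) = 1); [|lia].
    replace (N * (2 * j)) with (2 * (N * j)) in HNk by ring.
    replace ((2 * i + 1 - 1) * w) with (2 * (i * w)) in HNk by ring. lia. }
  (* Modulo p the powers A^N and B^N are X + sY and X - sY, where (X, Y) is the n-th power, so their
     sum is 2X = 0. *)
  assert (E : A ^ N mod p = (- B ^ N) mod p).
  {
    destruct HA as [a HA], HB as [b HB], HX as [c HX]. rewrite HX in HA, HB.
    replace (A ^ N) with (- B ^ N + (2 * c - a - b) * p) by lia.
    apply Z.mod_add; lia. }
  assert (E2 : A mod p = (- B) mod p).
  { rewrite <- (fermat_pow p A w), <- (fermat_pow p (- B) w) by (assumption || lia).
    rewrite <- HNk, !Z.pow_mul_r by lia.
    assert (HNo : Z.Odd N).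
    { destruct (Z.Even_or_Odd N) as [[j Hj]|]; [exfalso|assumption].
      destruct Hpo as [i Hi]. rewrite Hj, Hi in HNk.
      replace (2 * j * k) with (2 * (j * k)) in HNk by ring.
      replace ((2 * i + 1 - 1) * w) with (2 * (i * w)) in HNk by ring. lia. }
    rewrite (Z.pow_opp_odd B N HNo).
    rewrite Zpower_mod, E, <- Zpower_mod by lia. reflexivity. }
  assert (H2x : (p | 2 * x)).
  { replace (2 * x) with (A - - B) by (unfold A, B; ring).
    apply Z.mod_divide; [lia|]. rewrite Zminus_mod, E2, Z.sub_diag.
    apply Z.mod_0_l; lia. }
  apply Gauss with 2; [exact H2x|].
  apply rel_prime_sym, prime_rel_prime; [exact prime_2|].
  intros [j Hj]. destruct Hpo as [i Hi]. lia.
Qed.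

(** * Excluding m-th powers of elements of norm 1 by reduction modulo q *)

Definition qmod (m : Z) (p : Z * Z) : Z * Z := (fst p mod m, snd p mod m).

Lemma mod_eq_add_mul (a b m : Z) : a mod m = b mod m -> exists t, a = b + t * m.
Proof.
  intros H. destruct (Z.eq_dec m 0) as [->|Hm].
  - rewrite !Zmod_0_r in H. exists 0; lia.
  - exists (a / m - b / m).
    rewrite (Z.div_mod a m Hm) at 1. rewrite (Z.div_mod b m Hm) at 1. lia.
Qed.

Lemma qmod_mul (d m : Z) (p q r s : Z * Z) :
  qmod m p = qmod m q -> qmod m r = qmod m s ->
  qmod m (qmul d p r) = qmod m (qmul d q s).
Proof.
  unfold qmod, qmul; cbn [fst snd]. intros [= H1 H2] [= H3 H4].
  apply mod_eq_add_mul in H1 as [t1 ->], H2 as [t2 ->], H3 as [t3 ->],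
    H4 as [t4 ->].
  f_equal.
  - rewrite <- (Z_mod_plus_full (fst q * fst s + d * (snd q * snd s))
      (t1 * fst s + fst q * t3 + t1 * t3 * m +
       d * (t2 * snd s + snd q * t4 + t2 * t4 * m))). f_equal. ring.
  - rewrite <- (Z_mod_plus_full (fst q * snd s + snd q * fst s)
      (t1 * snd s + fst q * t4 + t1 * t4 * m +
       t2 * fst s + snd q * t3 + t2 * t3 * m)). f_equal. ring.
Qed.

Lemma qmod_pow (d m : Z) (p q : Z * Z) (n : nat) :
  qmod m p = qmod m q -> qmod m (qpow d p n) = qmod m (qpow d q n).
Proof.
  intros H; induction n as [|n IH]; [reflexivity|]. now apply qmod_mul.
Qed.

(** The first alternative discards pairs that are not residues of any element of norm 1. *)
Definition nonpower_test (d q : Z) (m : nat) (X Y : Z) : bool :=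
  let l := map Z.of_nat (seq 0 (Z.to_nat q)) in
  forallb (fun a => forallb (fun b =>
    negb ((qnorm d (a, b) - 1) mod q =? 0) ||
    (let r := qpow d (a, b) m in
     negb ((fst r mod q =? X mod q) && (snd r mod q =? Y mod q)))) l) l.

Lemma nonpower_test_spec (d q : Z) (m : nat) (X Y : Z) (p : Z * Z) :
  0 < q -> nonpower_test d q m X Y = true -> qnorm d p = 1 ->
  qpow d p m <> (X, Y).
Proof.
  intros Hq H Hn E. unfold nonpower_test in H.
  set (l := map Z.of_nat (seq 0 (Z.to_nat q))) in H.
  assert (Hl : forall z, In (z mod q) l).
  { intros z. assert (Hz := Z.mod_pos_bound z q Hq). apply in_map_iff.
    exists (Z.to_nat (z mod q)). split; [lia|]. apply in_seq; lia. }
  rewrite forallb_forall in H. specialize (H _ (Hl (fst p))).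
  rewrite forallb_forall in H. specialize (H _ (Hl (snd p))). cbv beta zeta in H.
  change (fst p mod q, snd p mod q) with (qmod q p) in H.
  assert (Hqq : qmod q (qmod q p) = qmod q p).
  { unfold qmod; cbn [fst snd]. now rewrite !Zmod_mod. }
  apply orb_prop in H as [H|H]; apply negb_true_iff in H.
  - apply Z.eqb_neq in H. apply H.
    unfold qmod in Hqq; cbn [fst snd] in Hqq. injection Hqq as H1 H2.
    apply mod_eq_add_mul in H1 as [t1 H1], H2 as [t2 H2].
    unfold qnorm in Hn |- *; cbn [fst snd]. rewrite <- Hn. unfold qmod; cbn [fst snd].
    rewrite H1, H2. apply Z.mod_divide; [lia|].
    exists (2 * fst p * t1 + t1 * t1 * q - d * (2 * snd p * t2 + t2 * t2 * q)).
    ring.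
  - apply (qmod_pow d q _ _ m) in Hqq. rewrite E in Hqq.
    unfold qmod at 1 3 in Hqq; cbn [fst snd] in Hqq.
    injection Hqq as H1 H2. rewrite H1, H2, !Z.eqb_refl in H. discriminate.
Qed.

(** For n = m j the n-th power is the m-th power of p^j, which again has norm 1. *)
Lemma exponent_not_multiple (d q : Z) (m n : nat) (X Y : Z) (p : Z * Z) :
  0 < q -> nonpower_test d q m X Y = true -> qnorm d p = 1 ->
  qpow d p n = (X, Y) -> ~ (Z.of_nat m | Z.of_nat n).
Proof.
  intros Hq H Hn E [j Hj].
  destruct (Nat.eq_dec m 0) as [->|Hm].
  - rewrite Z.mul_0_r in Hj. assert (n = O) by lia; subst n.
    exact (nonpower_test_spec d q 0 X Y p Hq H Hn E).
  - assert (Hj0 : 0 <= j) by nia.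
    replace n with (m * Z.to_nat j)%nat in E by nia.
    rewrite qpow_mul in E.
    apply (nonpower_test_spec d q m X Y _ Hq H) in E; [exact E|].
    now apply qnorm_pow.
Qed.

(** * The case d = 4099215 *)

Lemma not_condSC_4099215 : ~ condSC 4099215.
Proof.
  (* The period of the continued fraction of [sqrt 4099215] gives this unit. *)
  pose (X := 179784248540261720933717275307349853452493807225709008240438748235173454612609215996568096528066597886608903086961202826693607419247563810009098615761060747707904512388295534181151738333885074597018691093195456596933456700435124).
  pose (Y := 88797612801324763663461176430433623945738065366142957025775077607213519113867213685157937417087578913686280667664485149887151164667163604752315683478467408748036619796833159898856304466263945231456913593944419084835966054145).
  assert (Hp : prime 701).
  { apply prime_test_spec. vm_cast_no_check (eq_refl true). }
  apply (not_condSC_of_unit 4099215 701 X Y); [lia|exact Hp| | | |].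
  - apply Z.eqb_eq. vm_cast_no_check (eq_refl true).
  - apply Z.odd_spec. vm_cast_no_check (eq_refl true).
  - intros H. apply Z.mod_divide in H; [|lia].
    apply Z.eqb_eq in H. vm_compute in H. discriminate.
  - intros x y n Hn Hxy E.
    (* The elements of norm 1 form a group of order 20 modulo 19, where d is not a square, and of
       order 28 modulo 29, where it is; so 5th and 7th powers are proper subgroups. *)
    assert (H5 : ~ (Z.of_nat 5 | Z.of_nat n)).
    { apply (exponent_not_multiple 4099215 19 5 n (Z.abs X) (Z.abs Y) (x, y));
        [lia| |assumption ..].
      vm_cast_no_check (eq_refl true). }
    assert (H7 : ~ (Z.of_nat 7 | Z.of_nat n)).
    { apply (exponent_not_multiple 4099215 29 7 n (Z.abs X) (Z.abs Y) (x, y));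
        [lia| |assumption ..].
      vm_cast_no_check (eq_refl true). }
    (* Here 276 is a square root of d modulo 701. *)
    apply (divide_fst_of_divide_fst_qpow 4099215 701 276 x y n Hp).
    + exists 350; reflexivity.
    + vm_cast_no_check (eq_refl true).
    + apply Z.mod_divide; [lia|reflexivity].
    + assert (P5 : prime 5) by (apply prime_test_spec; reflexivity).
      assert (P7 : prime 7) by (apply prime_test_spec; reflexivity).
      change (701 - 1) with (2 * (2 * (5 * (5 * 7)))).
      assert (rel_prime (Z.of_nat n) 2).
      { apply rel_prime_sym, prime_rel_prime; [exact prime_2|].
        intros [j Hj]. destruct Hn as [i Hi]. lia. }
      assert (rel_prime (Z.of_nat n) 5)
        by (now apply rel_prime_sym, prime_rel_prime).
      assert (rel_prime (Z.of_nat n) 7)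
        by (now apply rel_prime_sym, prime_rel_prime).
      repeat (apply rel_prime_mult; [assumption|]). assumption.
    + rewrite E. cbn [fst]. apply Z.mod_divide; [lia|].
      apply Z.eqb_eq. vm_cast_no_check (eq_refl true).
Qed.

(** * The case d = 39028039587479: a unit known only through residues *)

(* [(M, a, b, N)] stands for an element of norm [N] whose coordinates are [a]
   and [b] modulo [M]. *)
Definition represented (d : Z) (st : Z * Z * Z * Z) : Prop :=
  let '(M, a, b, N) := st in
  exists A B, (M | A - a) /\ (M | B - b) /\ qnorm d (A, B) = N.

(* A step [(g, h, m)] replaces an element [e] by [e^2 (g + h sqrt d) / m]; the
   residues of [e] show that the quotient is integral, at the price of a factor
   [m] of the modulus. *)
Fixpoint square_and_reduce (d : Z) (steps : list (Z * Z * Z))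
    (st : Z * Z * Z * Z) : option (Z * Z * Z * Z) :=
  match steps with
  | nil => Some st
  | (g, h, m) :: steps' =>
      let '(M, a, b, N) := st in
      let r := qmul d (qmul d (a, b) (a, b)) (g, h) in
      let N' := N * N * qnorm d (g, h) in
      let M' := M / m in
      if (0 <? m) && (M mod m =? 0) && (fst r mod m =? 0) &&
         (snd r mod m =? 0) && (N' mod (m * m) =? 0)
      then square_and_reduce d steps'
             (M', (fst r / m) mod M', (snd r / m) mod M', N' / (m * m))
      else None
  end.

Lemma square_and_reduce_spec (d : Z) (steps : list (Z * Z * Z))
    (st st' : Z * Z * Z * Z) :
  represented d st -> square_and_reduce d steps st = Some st' ->
  represented d st'.
Proof.
  revert st; induction steps as [|[[g h] m] steps IH]; intros st H E.
  { injection E as <-. exact H. }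
  destruct st as [[[M a] b] N]. cbn [square_and_reduce] in E.
  set (r := qmul d (qmul d (a, b) (a, b)) (g, h)) in E.
  destruct ((0 <? m) && (M mod m =? 0) && (fst r mod m =? 0) &&
    (snd r mod m =? 0) && _) eqn:T in E; [|discriminate].
  rewrite !andb_true_iff, Z.ltb_lt, !Z.eqb_eq in T.
  destruct T as ((((Hm & HM) & H1) & H2) & H3).
  apply IH in E; [exact E|]. clear E IH.
  apply Z.div_exact in HM, H1, H2, H3; try nia.
  destruct H as (A & B & [t Ht] & [u Hu] & HN).
  set (M' := M / m) in *.
  set (f := fst r / m) in *. set (k := snd r / m) in *.
  (* The true product differs from that of the residues by multiples of M = m M', so its quotient by
     m is known modulo M'. *)
  assert (Hq : exists F G, qmul d (qmul d (A, B) (A, B)) (g, h) =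
    (m * (f + M' * F), m * (k + M' * G))).
  { assert (HA : A = a + t * M) by lia. assert (HB : B = b + u * M) by lia.
    exists ((2 * a * t + t * t * M + d * (2 * b * u + u * u * M)) * g +
       d * (2 * (a * u + t * b + t * u * M)) * h),
      ((2 * a * t + t * t * M + d * (2 * b * u + u * u * M)) * h +
       2 * (a * u + t * b + t * u * M) * g).
    rewrite !Z.mul_add_distr_l, <- H1, <- H2, !Z.mul_assoc, <- HM.
    unfold r, qmul; cbn [fst snd]. rewrite HA, HB. f_equal; ring. }
  destruct Hq as (F & G & Hq).
  exists (f + M' * F), (k + M' * G). repeat split.
  - exists (F + f / M'). destruct (Z.eq_dec M' 0) as [Z0|Hne].
    + rewrite Z0, Zmod_0_r. ring.
    + assert (Hd := Z.div_mod f M' Hne). lia.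
  - exists (G + k / M'). destruct (Z.eq_dec M' 0) as [Z0|Hne].
    + rewrite Z0, Zmod_0_r. ring.
    + assert (Hd := Z.div_mod k M' Hne). lia.
  - apply (f_equal (qnorm d)) in Hq. rewrite !qnorm_mul, HN in Hq.
    apply (Z.mul_reg_l _ _ (m * m)); [nia|].
    rewrite <- H3, Hq. unfold qnorm; cbn [fst snd]. ring.
Qed.

(* A unit of regulator about 4.3 * 10^6 is too long to be written out. The steps
   double the logarithm, and [g + h sqrt d] is a short vector of the lattice of
   those [z] for which [m] divides [e^2 z]: this keeps the norms below 2 * 10^6. *)
Definition unit_steps_39028039587479 : list (Z * Z * Z) :=
  (-704372952614740094082366357973439, -112749416401576400867177486, 1) ::
  (938891546101, -150289, 1490442980569) ::
  (838458301, 129, 67117884962) ::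
  (352825845, -131, 1272972871202) ::
  (3526867384, 559, 366962304818) ::
  (4695861244, -745, 1757939212129) ::
  (-2569965940, -411, 49110548881) ::
  (-28163075480657, -4508081, 60398469121) ::
  (5017428879, -802, 212336894450) ::
  (-1466019345, -244, 454832894569) ::
  (-4315645126321, 690808, 146957989201) ::
  (-196402531201, -31438, 431405944225) ::
  (-9019969989, 1457, 2451620035225) ::
  (36642422, 13, 184879427042) ::
  (-211494156443, 33854, 3229307929) ::
  (306117523, 49, 807419059225) ::
  (1, 0, 2) :: nil.

(** These residues say that 5 but not 25 divides X and that Y is odd. *)
Lemma unit_39028039587479 :
  exists X Y, qnorm 39028039587479 (X, Y) = 1 /\ (50 | X - 20) /\ (50 | Y - 9).
Proof.
  (* Each step divides the modulus by its m, so 50 times the product of all m leaves exactly 50 at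
     the end. The starting element is 1. *)
  set (M := fold_right (fun s z => snd s * z) 50 unit_steps_39028039587479).
  destruct (square_and_reduce_spec 39028039587479 unit_steps_39028039587479
    (M, 1, 0, 1) (50, 20, 9, 1)) as (X & Y & HX & HY & H).
  - exists 1, 0. repeat split; exists 0; reflexivity.
  - vm_cast_no_check (eq_refl (Some (50, 20, 9, 1))).
  - exists X, Y; auto.
Qed.

Lemma not_condSC_39028039587479 : ~ condSC 39028039587479.
Proof.
  destruct unit_39028039587479 as (X & Y & Hn & [a HX] & [b HY]).
  assert (Hp : prime 5) by (apply prime_test_spec; reflexivity).
  apply (not_condSC_of_unit 39028039587479 5 X Y); [lia|exact Hp|exact Hn| | |].
  - exists (25 * b + 4); lia.
  - intros [t Ht]. lia.
  - intros x y n Hno Hxy E.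
    (* Here d = 4 = 2^2 modulo 5, and p - 1 = 4 is a power of 2. *)
    apply (divide_fst_of_divide_fst_qpow 39028039587479 5 2 x y n Hp).
    + exists 2; reflexivity.
    + reflexivity.
    + apply Z.mod_divide; [lia|reflexivity].
    + change (5 - 1) with (2 * 2).
      assert (rel_prime (Z.of_nat n) 2); [|now apply rel_prime_mult].
      apply rel_prime_sym, prime_rel_prime; [exact prime_2|].
      intros [j Hj]. destruct Hno as [i Hi]. lia.
    + rewrite E. apply Z.divide_abs_r. exists (10 * a + 4). lia.
Qed.

(** * From (SC) to (C), and the four members of [L] that are 7 modulo 8 *)

Lemma not_condSC_of_not_condC (d : Z) : ~ condC d -> ~ condSC d.
Proof.
  intros H (Hd & eps & Hf & x & y & Hx & Hy & E & Hpow & Hyo & Hdy). apply H.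
  (* Condition (SC) is the case k = 1 of (C), because [omega d] is sqrt d here. *)
  split; [exact Hd|]. exists eps; split; [exact Hf|]. exists 1, x, y.
  rewrite (omega_sqrt d (mod8_mod4 d Hd)) in E. rewrite powerRZ_1.
  assert (0 < x) by apply Hpow.
  assert (0 < y) by (destruct Hyo; lia).
  assert (Z.Odd 1) by (exists 0; reflexivity).
  assert (0 < 1) by lia. tauto.
Qed.

Lemma mod8_of_L (d : Z) :
  In d L -> d mod 8 = 7 ->
  d = 209991 \/ d = 4099215 \/ d = 117477414815 \/ d = 39028039587479.
Proof.
  intros H Hd.
  assert (Hf : In d (filter (fun z => z mod 8 =? 7) L))
    by (apply filter_In; split; [exact H|now apply Z.eqb_eq]).
  simpl in Hf. intuition.
Qed.

Theorem mainTheorem5 :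
  (forall d : Z, In d L -> squarefree d) /\
  (forall d : Z, In d L -> ~ condSC d) /\
  (forall d : Z, In d L -> d <> 4099215 -> d <> 39028039587479 -> ~ condC d).
Proof.
  split; [exact squarefree_L|split].
  - intros d Hd H. destruct (mod8_of_L d Hd (proj1 H)) as [->|[->|[->| ->]]].
    + exact (not_condSC_of_not_condC _ not_condC_209991 H).
    + exact (not_condSC_4099215 H).
    + exact (not_condSC_of_not_condC _ not_condC_117477414815 H).
    + exact (not_condSC_39028039587479 H).
  - intros d Hd Hn1 Hn2 H.
    destruct (mod8_of_L d Hd (proj1 H)) as [->|[->|[->| ->]]].
    + exact (not_condC_209991 H).
    + now apply Hn1.
    + exact (not_condC_117477414815 H).
    + now apply Hn2.
Qed.
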